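(* Let $S$ be a numerical semigroup, $E$ a nonempty semigroup ideal of $S$, and $m \in S$ an odd integer. Then the numerical duplication $D = S \Join^m E$ is an Arf numerical semigroup if and only if all of the following hold: (i) $S$ is an Arf numerical semigroup, with multiplicity sequence written as $(e_0,e_1,\ldots,e_{n-1},1,1,\ldots)$, where $e_{n-1}\neq 1$ (that is, $n\in\mathbb{N}$ is the smallest integer such that $e_k=1$ for all $k\ge n$); (ii) $E$ is integrally closed; (iii) if $\min(E) < c(S)$, then $e_0=e_1=\cdots=e_{n-1}=m$.
   Context: A numerical semigroup is an additive submonoid $S$ of $\mathbb{N}=\{0,1,2,\ldots\}$ with finite complement in $\mathbb{N}$. Its conductor is $c(S)=\max(\mathbb{Z}\setminus S)+1$ if $S\ne\mathbb{N}$, and $c(\mathbb{N})=0$. A semigroup ideal of $S$ is a subset $E\subseteq S$ with $E+S\subseteq E$. It is integrally closed if $E=\{s\in S: s\ge \min E\}$. For $A\subseteq\mathbb{Z}$, $2\cdot A=\{2a:a\in A\}$. For a semigroup ideal $E$ and an odd integer $m\in S$, the numerical duplication is the numerical semigroup $S\Join^m E=2\cdot S\cup(2\cdot E+m)$. $S$ is Arf if $x+y-z\in S$ for all $x,y,z\in S$ with $x\ge y\ge z$. If $S=\{0=s_0<s_1<s_2<\cdots\}$ is Arf, its multiplicity sequence is $(e_0,e_1,e_2,\ldots)$ with $e_i=s_{i+1}-s_i$; it is non-increasing and eventually equal to $1$. If $n=0$ (i.e. $S=\mathbb{N}$), the condition $e_{n-1}\ne1$ is void. *)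

(* Defs.v *)
From mathcomp Require Import all_boot all_order all_algebra.
From mathcomp Require Import boolp classical_sets cardinality.

Set Implicit Arguments.
Unset Strict Implicit.
Unset Printing Implicit Defensive.

Local Open Scope classical_set_scope.

(* [xget 0 P] is an element of [P], or the junk value 0 when [P] is empty;
   hence [set_min A] is min A for nonempty [A], and [set_max A] is max A
   for [A] nonempty and bounded above. *)
Definition set_min (A : set nat) : nat := xget 0%N (A `&` lbound A).
Definition set_max (A : set int) : int := xget 0%R (A `&` ubound A).

Definition numerical_semigroup (S : set nat) : Prop :=
  [/\ S 0%N, forall x y, S x -> S y -> S (x + y)%N & finite_set (~` S)].

(* The complement is taken in the integers. *)
Definition conductor (S : set nat) : int :=
  if `[< S = [set: nat] >] then 0%R
  else (set_max (~` [set Posz s | s in S]) + 1)%R.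

Definition semigroup_ideal (S E : set nat) : Prop :=
  E `<=` S /\ forall e s, E e -> S s -> E (e + s)%N.

Definition integrally_closed (S E : set nat) : Prop :=
  E = [set s | S s /\ (set_min E <= s)%N].

Definition duplication (S E : set nat) (m : nat) : set nat :=
  [set (2 * s)%N | s in S] `|` [set (2 * e + m)%N | e in E].

(* Since z <= y, the truncated subtraction of nat is the integer one here. *)
Definition arf_condition (S : set nat) : Prop :=
  forall x y z, S x -> S y -> S z ->
    (z <= y)%N -> (y <= x)%N -> S (x + y - z)%N.

Definition arf_semigroup (S : set nat) : Prop :=
  numerical_semigroup S /\ arf_condition S.

(* The increasing enumeration s_0 < s_1 < ... of an infinite set. *)
Fixpoint set_nth_elt (S : set nat) (i : nat) : nat :=
  if i is j.+1 then set_min [set s | S s /\ (set_nth_elt S j < s)%N]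
  else set_min S.

Definition mult_seq (S : set nat) (i : nat) : nat :=
  (set_nth_elt S i.+1 - set_nth_elt S i)%N.

(* The smallest n such that e_k = 1 for all k >= n; such an n exists for
   every numerical semigroup. *)
Definition mult_len (S : set nat) : nat :=
  set_min [set n | forall k, (n <= k)%N -> mult_seq S k = 1%N].

(* Main.v *)
(* The even part of D = 2S u (2E + m) gives that S is Arf, and
   2s + (2 min E + m) - 2 min E = 2s + m gives that E is integrally closed. If
   min E < c(S), the last element a of S below c(S) lies in E, and playing
   2a + m against the even elements above 2 c(S) forces e_(n-1) = m; as the
   multiplicity sequence is non-increasing and e_0 <= m (because m is in S), all
   the e_i with i < n equal m. Conversely, x + y - z >= x when x >= y >= z, so
   when E contains every integer >= min E only parities matter; otherwise
   S = {0, m, ..., nm, ->}, min E = jm, and D consists of multiples of m up to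
   its large elements. *)
Require Import Defs.
From mathcomp Require Import all_boot all_order all_algebra.
From mathcomp Require Import boolp classical_sets cardinality.
From mathcomp Require Import zify.
Import Order.TTheory.

Local Open Scope classical_set_scope.

Set Implicit Arguments.
Unset Strict Implicit.

(** * Minima, maxima and cofinite sets of naturals *)

Lemma set_minP (A : set nat) : A !=set0 ->
  A (set_min A) /\ forall x, A x -> (set_min A <= x)%N.
Proof.
move=> [x0 Ax0].
suff [y [Ay yA]] : (A `&` lbound A) !=set0.
  by rewrite /set_min; case: xgetP => [z _ [Az lbA]|/(_ y)[]]; split.
have exA : exists n, `[< A n >] by exists x0; apply/asboolP.
case: (ex_minnP exA) => y /asboolP Ay ymin.
by exists y; split=> // x Ax; rewrite leEnat; apply: ymin; apply/asboolP.
Qed.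

Lemma set_max_eq (A : set int) (M : int) :
  A M -> (forall x, A x -> (x <= M)%R) -> set_max A = M.
Proof.
move=> AM ubM; apply: xget_unique; first by split.
by move=> y [Ay uby]; apply/eqP; rewrite eq_le ubM //=; exact: uby.
Qed.

Lemma cofinite_ge (S : set nat) :
  finite_set (~` S) <-> exists N, forall x, (N <= x)%N -> S x.
Proof.
split.
  case/finite_seqP => s sE; exists (\max_(i <- s) i)%N.+1 => x xgt.
  apply: contrapT => nSx.
  have xs : x \in s by have : (~` S) x by []; rewrite sE.
  by move: xgt; rewrite ltnNge (@leq_bigmax_seq _ s xpredT id x xs isT).
case=> N geN; apply: (@sub_finite_set _ _ `I_N); last exact: finite_II.
by move=> x nSx; rewrite /= ltnNge; apply/negP => /geN.
Qed.

(** * Enumeration, multiplicity sequence and conductor *)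

Section Enumeration.
Variable S : set nat.
Hypothesis hS : numerical_semigroup S.
Local Notation s := (set_nth_elt S).

Lemma next_elt (a : nat) : [set x | S x /\ (a < x)%N] !=set0.
Proof.
have [_ _ /cofinite_ge[N geN]] := hS.
by exists (maxn N a.+1); split; [apply: geN; rewrite leq_maxl|rewrite leq_maxr].
Qed.

Lemma nth_eltS k :
  [/\ S (s k.+1), (s k < s k.+1)%N &
      forall x, S x -> (s k < x)%N -> (s k.+1 <= x)%N].
Proof.
by have [[? ?] h] := set_minP (next_elt (s k)); split=> // x Sx ltx; exact: h.
Qed.

Lemma nth_elt0 : s 0 = 0%N.
Proof.
have [S0 _ _] := hS.
by have [_ h] := set_minP (ex_intro _ 0%N S0); apply/eqP; rewrite -leqn0 h.
Qed.

Lemma nth_elt_in k : S (s k).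
Proof. by case: k => [|k]; [rewrite nth_elt0; case: hS|case: (nth_eltS k)]. Qed.

Lemma leq_nth_elt k : (k <= s k)%N.
Proof. by elim: k => // k IH; case: (nth_eltS k); lia. Qed.

Lemma nth_elt_surj k x : S x -> (x < s k)%N -> exists2 j, (j < k)%N & x = s j.
Proof.
elim: k => [|k IH] Sx; first by rewrite nth_elt0.
case: (nth_eltS k) => _ _ next ltx; case: (ltngtP x (s k)) => [xlt|xgt|->].
- by have [j ? ?] := IH Sx xlt; exists j => //; lia.
- by have := next _ Sx xgt; lia.
- by exists k.
Qed.

Lemma mult_seqE k : s k.+1 = (s k + mult_seq S k)%N.
Proof. by rewrite /mult_seq; case: (nth_eltS k); lia. Qed.

Lemma mult_lenP :
  (forall k, (mult_len S <= k)%N -> mult_seq S k = 1%N) /\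
  forall n, (forall k, (n <= k)%N -> mult_seq S k = 1%N) -> (mult_len S <= n)%N.
Proof.
apply: (@set_minP [set n | forall k, (n <= k)%N -> mult_seq S k = 1%N]).
have [_ _ /cofinite_ge[N geN]] := hS; exists N => k leNk.
have [_ lt_s next] := nth_eltS k.
have : (s k.+1 <= (s k).+1)%N.
  by apply: next => //; apply: geN; have := leq_nth_elt k; lia.
by rewrite /mult_seq; lia.
Qed.

Lemma mult_seq_pred_mult_len n : mult_len S = n.+1 -> (2 <= mult_seq S n)%N.
Proof.
move=> lenE; have [ge1 min1] := mult_lenP.
have gt0 : (0 < mult_seq S n)%N by rewrite /mult_seq; case: (nth_eltS n); lia.
rewrite ltn_neqAle gt0 andbT; apply/eqP => n1.
suff : (mult_len S <= n)%N by lia.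
apply: min1 => k; rewrite leq_eqVlt => /orP[/eqP<- //|ltnk].
by apply: ge1; rewrite lenE.
Qed.

(** From index [mult_len S] on, the enumeration advances by steps of 1 and so meets every
    integer. *)
Lemma mem_ge_nth_mult_len x : (s (mult_len S) <= x)%N -> S x.
Proof.
have [ge1 _] := mult_lenP => lex.
suff -> : x = s (mult_len S + (x - s (mult_len S))) by exact: nth_elt_in.
have shift t : s (mult_len S + t) = (s (mult_len S) + t)%N.
  elim: t => [|t IH]; first by rewrite !addn0.
  by rewrite addnS mult_seqE IH ge1 ?leq_addr //; lia.
by rewrite shift; lia.
Qed.

(** This trades the integer conductor for a bound on naturals. If [C] is the least threshold from
    which [S] is full and [S] is not everything, then [C > 0] and [C - 1] is the largest missing
    integer, above all the negative ones. *)
Lemma conductor_le (x : nat) :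
  (conductor S <= Posz x)%R <-> forall y, (x <= y)%N -> S y.
Proof.
rewrite /conductor; case: asboolP => [-> //|nST].
have [_ _ /cofinite_ge exN] := hS.
have [geC minC] := set_minP exN; set C := set_min _ in geC minC.
have C_gt0 : (0 < C)%N.
  rewrite lt0n; apply/eqP => C0; apply: nST.
  by apply/seteqP; split=> // y _; apply: geC; rewrite C0.
have nSC : ~ S C.-1.
  move=> SC; suff : (C <= C.-1)%N by lia.
  apply: minC => y; rewrite leq_eqVlt => /orP[/eqP<- //|lty].
  by apply: geC; lia.
rewrite (@set_max_eq _ (Posz C.-1)).
- have -> : ((Posz C.-1 + 1 <= Posz x)%R) = (C <= x)%N by lia.
  split=> [leCx y lexy|]; last exact: minC.
  by apply: geC; lia.
- by move=> [t St [tE]]; apply: nSC; rewrite -tE.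
- move=> y; case: y => [t|t] nSt; last by lia.
  rewrite leNgt; apply/negP => ltt; apply: nSt; exists t => //.
  by apply: geC; lia.
Qed.

End Enumeration.

(** The Arf condition puts 2 s_(j+1) - s_j in [S], so the gap after s_(j+1) is at most the one
    before it. *)
Lemma mult_seq_noninc (S : set nat) (i j : nat) :
  arf_semigroup S -> (i <= j)%N -> (mult_seq S j <= mult_seq S i)%N.
Proof.
move=> [hS arfS]; elim: j => [|j IH]; first by rewrite leqn0 => /eqP->.
rewrite leq_eqVlt => /orP[/eqP-> //|leij].
apply: leq_trans (IH leij).
have [_ ltj _] := nth_eltS hS j; have [_ ltj1 next] := nth_eltS hS j.+1.
have /next : S (set_nth_elt S j.+1 + set_nth_elt S j.+1 - set_nth_elt S j)%N.
  by apply: arfS => //; try exact: nth_elt_in; exact: ltnW.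
by rewrite /mult_seq; lia.
Qed.

(** * The duplication as a semigroup; necessity of the conditions *)

Section Duplication.
Variables (S E : set nat) (m : nat).
Hypotheses (hS : numerical_semigroup S) (hE : semigroup_ideal S E).
Hypotheses (hE0 : E !=set0) (hmS : S m) (hm : odd m).
Local Notation D := (duplication S E m).

Lemma duplication_even x : D (2 * x)%N <-> S x.
Proof.
split=> [[[y Sy yE]|[y Ey yE]]|Sx]; last by left; exists x.
- by have <- : y = x by lia.
- by move: hm; lia.
Qed.

Lemma duplication_odd x : D (2 * x + m)%N <-> E x.
Proof.
split=> [[[y Sy yE]|[y Ey yE]]|Ex]; last by right; exists x.
- by move: hm; lia.
- by have <- : y = x by lia.
Qed.

Lemma duplication_numerical_semigroup : numerical_semigroup D.
Proof.
have [S0 SD /cofinite_ge[N geN]] := hS; have [ES EI] := hE; have [e0 Ee0] := hE0.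
split.
- by rewrite -(muln0 2); apply/duplication_even.
- move=> _ _ [[x Sx <-]|[x Ex <-]] [[y Sy <-]|[y Ey <-]].
  + by rewrite -mulnDr; apply/duplication_even/SD.
  + have -> : (2 * x + (2 * y + m) = 2 * (y + x) + m)%N by lia.
    exact/duplication_odd/EI.
  + have -> : (2 * x + m + 2 * y = 2 * (x + y) + m)%N by lia.
    exact/duplication_odd/EI.
  + have -> : (2 * x + m + (2 * y + m) = 2 * (x + y + m))%N by lia.
    by apply/duplication_even/(SD _ _ _ hmS)/SD; exact: ES.
(* Beyond this bound, an even [x] has its half above [N], and for an odd [x] the number (x - m)/2 is
   [e0] plus an element of [S], hence in [E]. *)
- apply/cofinite_ge; exists (2 * (N + e0) + m)%N => x lex.
  have [evx|oddx] : (x = 2 * x./2 \/ x = 2 * (x - m)./2 + m)%N by move: hm; lia.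
  + by rewrite evx; apply/duplication_even/geN; lia.
  + rewrite oddx; apply/duplication_odd.
    have -> : ((x - m)./2 = e0 + ((x - m)./2 - e0))%N by lia.
    by apply: EI => //; apply: geN; lia.
Qed.

Lemma duplication_arf_base : arf_condition D -> arf_condition S.
Proof.
move=> arfD x y z Sx Sy Sz lezy leyx; apply/duplication_even.
have -> : (2 * (x + y - z) = 2 * x + 2 * y - 2 * z)%N by lia.
by apply: arfD; rewrite ?leq_mul2l //; exact/duplication_even.
Qed.

Lemma arf_condition_sym (A : set nat) x y z : arf_condition A ->
  A x -> A y -> A z -> (z <= y)%N -> (z <= x)%N -> A (x + y - z)%N.
Proof.
move=> arfA Ax Ay Az zy zx; case: (leqP y x) => [yx|xy]; first exact: arfA.
by rewrite addnC; apply: arfA => //; exact: ltnW.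
Qed.

Lemma duplication_arf_closed : arf_condition D -> integrally_closed S E.
Proof.
move=> arfD; have [Ee0 mine0] := set_minP hE0; have [ES _] := hE.
apply/seteqP; split=> [x Ex|x [Sx lex]]; first by split; [exact: ES|exact: mine0].
apply/duplication_odd; set e0 := set_min E in Ee0 lex *.
have -> : (2 * x + m = 2 * x + (2 * e0 + m) - 2 * e0)%N by lia.
apply: arf_condition_sym => //; try lia.
- exact/duplication_even.
- exact/duplication_odd.
- exact/duplication_even/ES.
Qed.

(* With [a < a + g] the last gap before the conductor, the shift [m] of the
   odd part must equal [g], since otherwise an element of [S] falls in the gap:
   [a + m] if [m < g]; [a + 2g - m] if [g < m < 2g], by reflecting [2a + m] in
   [2(a + g)]; [a + 1] if [2g < m], by adding to [2a + m] the difference [2] of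
   two even elements. *)
Lemma duplication_arf_last_gap (a g : nat) : arf_condition D ->
  E a -> (2 <= g)%N -> (forall x, (a < x)%N -> S x -> (a + g <= x)%N) ->
  (forall x, (a + g <= x)%N -> S x) -> m = g.
Proof.
move=> arfD Ea g2 gap geS; have [ES _] := hE; have [_ SD _] := hS.
have m_gt0 : (0 < m)%N by exact: odd_gt0.
have Da : D (2 * a + m)%N by exact/duplication_odd.
have legm : (g <= m)%N.
  by have := gap (a + m)%N ltac:(lia) (SD _ _ (ES _ Ea) hmS); lia.
case: (ltngtP m (2 * g)) => [m2g|m2g|]; last by move: hm; lia.
- have : D (2 * (a + g) + 2 * (a + g) - (2 * a + m))%N.
    by apply: arfD => //; try lia; apply/duplication_even/geS.
  have -> : (2 * (a + g) + 2 * (a + g) - (2 * a + m)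
             = 2 * (a + 2 * g - m) + m)%N by lia.
  by move/duplication_odd/ES/gap; lia.
- have : D (2 * a + m + 2 * (a + g + 1) - 2 * (a + g))%N.
    apply: arf_condition_sym => //; try lia.
    + by apply/duplication_even/geS; lia.
    + exact/duplication_even/geS.
  have -> : (2 * a + m + 2 * (a + g + 1) - 2 * (a + g) = 2 * (a + 1) + m)%N.
    by lia.
  by move/duplication_odd/ES/gap; lia.
Qed.

Lemma duplication_arf_mult_seq : arf_condition D ->
  (Posz (set_min E) < conductor S)%R ->
  forall k : nat, (k < mult_len S)%N -> mult_seq S k = m.
Proof.
move=> arfD ltc k ltk.
have arfS : arf_semigroup S by split=> //; exact: duplication_arf_base.
case lenE : (mult_len S) ltk => [//|n] ltk.
have nE := mult_seqE hS n; have n2 := mult_seq_pred_mult_len hS lenE.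
have [_ _ next] := nth_eltS hS n.
have geS := mem_ge_nth_mult_len hS; rewrite lenE in geS.
(* The length is n + 1 here, so s_n is the last element before the final run. As min E lies in [S]
   below s_(n+1), it is at most s_n, and integral closure puts s_n in [E]. *)
have lt_min : (set_min E < set_nth_elt S n.+1)%N.
  rewrite ltnNge; apply/negP => le_s; move: ltc; rewrite ltNge => /negP; apply.
  by apply/(conductor_le hS) => y ley; apply: geS; exact: leq_trans ley.
have le_min : (set_min E <= set_nth_elt S n)%N.
  have [Emin _] := set_minP hE0; have [ES _] := hE.
  by rewrite leqNgt; apply/negP => /(next _ (ES _ Emin)); lia.
have En : E (set_nth_elt S n).
  by rewrite (duplication_arf_closed arfD); split=> //; exact: nth_elt_in.
have mE : m = mult_seq S n.
  apply: (@duplication_arf_last_gap _ _ arfD En n2) => x; rewrite -nE; last exact: geS.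
  by move=> ltx Sx; exact: next.
(* Since [m] is a positive element of [S], e_0 = s_1 <= m; then m = e_n <= e_k <= e_0 <= m. *)
have s0 := nth_elt0 hS; have s1 := mult_seqE hS 0.
have [_ _ next0] := nth_eltS hS 0.
have := next0 m hmS; rewrite s1 s0 (odd_gt0 hm) => /(_ isT).
have := mult_seq_noninc arfS (leq0n k).
have /(mult_seq_noninc arfS) : (k <= n)%N by lia.
lia.
Qed.

(** * Sufficiency of the conditions *)

Lemma duplication_arf_ge_conductor :
  arf_condition S -> integrally_closed S E ->
  (forall y, (set_min E <= y)%N -> S y) -> arf_condition D.
Proof.
move=> arfS closedE geS; rewrite closedE; move: (set_min E) geS => e0 geS.
have inD x : (2 * e0 + m <= x)%N -> duplication S [set s | S s /\ (e0 <= s)%N] m x.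
  move=> lex.
  have [evx|oddx] : (x = 2 * x./2 \/ x = 2 * (x - m)./2 + m)%N by move: hm; lia.
  - by left; exists x./2; [apply: geS; lia|].
  - right; exists ((x - m)./2)%N; last by [].
    by split; [apply: geS; lia|lia].
(* If any of the three comes from the odd part, then [x], and with it x + y - z, is at least 2 e0 +
   m. Only the case of three even elements needs [S] to be Arf. *)
move=> x y z [[x' Sx <-]|[x' [Sx x'ge] <-]] [[y' Sy <-]|[y' [Sy y'ge] <-]]
  [[z' Sz <-]|[z' [Sz z'ge] <-]] lezy leyx; try (apply: inD; lia).
by left; exists (x' + y' - z')%N; [apply: arfS => //; lia|lia].
Qed.

(* The case [S = {0, m, ..., n m, ->}] and [min E = j m]. *)
Lemma duplication_arf_multiples (n j : nat) :
  (forall x, S x <-> (n * m <= x)%N \/ exists q, x = (q * m)%N) ->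
  (forall x, E x <-> S x /\ (j * m <= x)%N) -> (j <= n)%N -> arf_condition D.
Proof.
move=> SE EE lejn.
have m_gt0 : (0 < m)%N by exact: odd_gt0.
have DE x : D x <-> (exists2 q, x = (q * m)%N & ~~ odd q \/ (2 * j < q)%N) \/
   (2 * (n * m) <= x)%N /\ (~~ odd x \/ (2 * (n * m) + m <= x)%N).
  split.
  - case=> [[y /SE[ley|[q ->]] <-]|[y /EE[/SE[ley|[q ->]] lejy] <-]].
    + by right; lia.
    + by left; exists (2 * q)%N; [rewrite mulnA|lia].
    + by right; lia.
    + left; exists (2 * q).+1; first by rewrite [RHS]mulSn -mulnA addnC.
      by move: lejy; rewrite leq_pmul2r //; lia.
  - have mulS q : S (q * m)%N by apply/SE; right; exists q.
    case=> [[q -> [evq|oddq]]|[lex evx]].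
    + have -> : (q * m = 2 * (q./2 * m))%N by rewrite mulnA; congr muln; lia.
      exact/duplication_even.
    + have [evq|odq] : (q = 2 * q./2 \/ q = (2 * q./2).+1)%N by lia.
        by rewrite evq -mulnA; apply/duplication_even.
      rewrite odq mulSn -mulnA addnC; apply/duplication_odd/EE; split=> //.
      by rewrite leq_pmul2r //; lia.
    + have [xE|[xE lex']] : (x = 2 * x./2 \/
          x = 2 * (x - m)./2 + m /\ 2 * (n * m) + m <= x)%N by move: hm; lia.
        by rewrite xE; apply/duplication_even/SE; left; lia.
      rewrite xE; apply/duplication_odd/EE; split; first by apply/SE; left; lia.
      by apply: (@leq_trans (n * m)); [rewrite leq_pmul2r|lia].
(* An odd multiple of [m] differs from 2nm by at least [m]. *)
have D_odd w : D w -> odd w -> (w + m <= 2 * (n * m) \/ 2 * (n * m) + m <= w)%N.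
  move/DE=> [[q -> _]|[]]; last by lia.
  rewrite oddM hm andbT mulnA [(_ + m)%N]addnC [X in _ \/ (X <= _)%N]addnC -!mulSn.
  by rewrite !leq_pmul2r //; lia.
have D_gap w t : D w -> D t -> (w < t)%N -> (t < 2 * (n * m))%N -> (w + m <= t)%N.
  move=> /DE[[p -> _]|]; last by lia.
  move=> /DE[[q -> _]|]; last by lia.
  by rewrite [(_ + m)%N]addnC -mulSn ltn_pmul2r // leq_pmul2r.
move=> x y z Dx Dy Dz lezy leyx; apply/DE.
have [lex|ltx] := leqP (2 * (n * m)) x.
  have Ox := D_odd _ Dx; have Oy := D_odd _ Dy; have Oz := D_odd _ Dz.
  have Gzy := D_gap _ _ Dz Dy.
  have [ov|ev] := boolP (odd (x + y - z)); last by right; split; [lia|left].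
  (* If [x] is below 2nm + m, it is even, so exactly one of [y], [z] is odd. By [D_odd] and [D_gap]
     they are at least [m] apart, and x + y - z reaches 2nm + m. *)
  have [big|small] := leqP (2 * (n * m) + m) x; first by right; lia.
  right; split; first by lia.
  by right; lia.
move: Dx Dy Dz => /DE[[a aE ha]|]; last by lia.
move=> /DE[[b bE hb]|]; last by lia.
move=> /DE[[c cE hc]|]; last by lia.
(* If a > 2j, then a + b - c >= a > 2j; otherwise [a], [b], [c] are all even. *)
left; exists (a + b - c)%N; first by rewrite aE bE cE mulnBl mulnDl.
by move: lezy leyx; rewrite aE bE cE !leq_pmul2r //; lia.
Qed.

End Duplication.

Unset Implicit Arguments.
Set Strict Implicit.

Theorem theorem2p4 (S E : set nat) (m : nat)
    (hS : numerical_semigroup S)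
    (hE : semigroup_ideal S E) (hE0 : E !=set0)
    (hmS : S m) (hm : odd m) :
  arf_semigroup (duplication S E m) <->
  [/\ arf_semigroup S,
      integrally_closed S E &
      (Posz (set_min E) < conductor S)%R ->
        forall k : nat, (k < mult_len S)%N -> mult_seq S k = m].
Proof.
split=> [[_ arfD]|[[_ arfS] closedE multS]].
  split; first by split=> //; exact: duplication_arf_base arfD.
    exact: duplication_arf_closed arfD.
  exact: duplication_arf_mult_seq arfD.
split; first exact: duplication_numerical_semigroup.
have [S0 SD _] := hS; have [Emin _] := set_minP hE0; have [ES _] := hE.
have [lec|ltc] := leP (conductor S) (Posz (set_min E)).
  by apply: duplication_arf_ge_conductor => //; apply/conductor_le.
(* Constant multiplicities make [S] the multiples of [m] up to the final run; min E, being below the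
   conductor, is one of them. *)
have nthE k : (k <= mult_len S)%N -> set_nth_elt S k = (k * m)%N.
  elim: k => [_|k IH ltk]; first exact: nth_elt0.
  by rewrite (mult_seqE hS) IH ?multS // 1?ltnW // mulSn addnC.
have geS := mem_ge_nth_mult_len hS; rewrite nthE // in geS.
have nthS x : S x -> (x < mult_len S * m)%N ->
    exists2 q, (q < mult_len S)%N & x = (q * m)%N.
  move=> Sx; rewrite -nthE // => /(nth_elt_surj hS Sx)[q ltq ->].
  by exists q => //; apply/nthE/ltnW.
have lt_min : (set_min E < mult_len S * m)%N.
  rewrite ltnNge; apply/negP => le_s; move: ltc; rewrite ltNge => /negP; apply.
  by apply/(conductor_le hS) => y ley; apply: geS; exact: leq_trans ley.
have [j ltj minE] := nthS _ (ES _ Emin) lt_min.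
apply: (@duplication_arf_multiples _ _ _ hm (mult_len S) j); last exact: ltnW.
- move=> x; split=> [Sx|[/geS //|[q ->]]].
    by have [|/(nthS _ Sx)[q _ ->]] := leqP (mult_len S * m) x;
      [left|right; exists q].
  by elim: q => // q IH; rewrite mulSn; exact: SD.
- by move=> x; rewrite {1}closedE /= minE.
Qed.
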